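(* Let $V$ be an $\mathbb{R}^d$-valued random vector whose law $P_V$ has a Lebesgue density $f_V$, and assume that its characteristic function satisfies $\varphi_V(\omega)\neq 0$ for Lebesgue-a.e. $\omega\in\mathbb{R}^d$. Then for every $\lambda\in C_0(\mathbb{R}^d;\mathbb{C})$ there exists a unique continuous linear functional $\mathcal{T}_{\lambda,V}\in\mathcal{A}_V'(\mathbb{R}^d)$ such that \[ \mathcal{T}_{\lambda,V}\bigl[\mathcal{K}_V[\mu]\bigr]=\int_{\mathbb{R}^d}\lambda(x)\,d\mu(x)\qquad\text{for all }\mu\in\mathcal{M}(\mathbb{R}^d). \] In particular, if $X$ is an $\mathbb{R}^d$-valued random vector independent of $V$ with law $P_X$ and $Y=X+V$, then the density of $Y$ is $f_Y=\mathcal{K}_V[P_X]$ and \[ \mathcal{T}_{\lambda,V}[f_Y]=\int_{\mathbb{R}^d}\lambda(x)\,dP_X(x). \]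
   Context: $\varphi_V(\omega)=\mathbb{E}[e^{i\omega^\top V}]$. $\mathcal{M}(\mathbb{R}^d)$ is the Banach space of finite signed (complex allowed) Radon measures on $\mathbb{R}^d$ with the total variation norm $\|\mu\|_{TV}=\sup\{|\int h\,d\mu|: h\in C_0(\mathbb{R}^d),\|h\|_\infty\le 1\}$. The convolution operator is $\mathcal{K}_V[\mu](y)=(f_V*\mu)(y)=\int f_V(y-x)\,d\mu(x)$, mapping $\mathcal{M}(\mathbb{R}^d)$ into $L^1(\mathbb{R}^d;\mathbb{C})$. The space of $V$-admissible mixtures is $\mathcal{A}_V(\mathbb{R}^d)=\{f_V*\mu:\mu\in\mathcal{M}(\mathbb{R}^d)\}$; under the nonvanishing assumption on $\varphi_V$ the representing measure $\mu$ of each $f\in\mathcal{A}_V$ is unique and $\mathcal{A}_V$ is normed by $\|f\|_{\mathcal{A}_V}=\|\mu\|_{TV}$ where $f=f_V*\mu$. $\mathcal{A}_V'(\mathbb{R}^d)$ denotes the space of continuous linear functionals on $(\mathcal{A}_V(\mathbb{R}^d),\|\cdot\|_{\mathcal{A}_V})$. $C_0$ denotes continuous functions vanishing at infinity. *)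

(* Defs.v *)
From HB Require Import structures.
From mathcomp Require Import all_boot all_order all_algebra.
From mathcomp Require Import all_classical all_reals all_analysis.
From mathcomp Require Import complex.

Set Implicit Arguments.
Unset Strict Implicit.
Unset Printing Implicit Defensive.

Import Order.TTheory GRing.Theory Num.Theory.
Local Open Scope ring_scope.
Local Open Scope classical_set_scope.

Section Defs.
Context {R : realType} {d : nat}.
Local Notation Rd := (d.-tuple R).
(* R^d is modelled by [d.-tuple R], equipped with the library's product
   (= Borel) sigma-algebra built from the Borel sigma-algebra of R. *)

Definition tadd (x y : Rd) : Rd := [tuple tnth x i + tnth y i | i < d].
Definition tsub (x y : Rd) : Rd := [tuple tnth x i - tnth y i | i < d].
Definition tdot (x y : Rd) : R := \sum_(i < d) tnth x i * tnth y i.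
(* sup-norm on R^d (all norms on R^d are equivalent) *)
Definition tnorm (x : Rd) : R := \big[Num.max/0]_(i < d) `|tnth x i|.

Definition creal (z : R[i]) : R := let: Complex a _ := z in a.
Definition cimag (z : R[i]) : R := let: Complex _ b := z in b.
Definition cnorm (z : R[i]) : R := Normc.normc z.

Definition box (a b : Rd) : set Rd :=
  [set x | forall i, tnth a i <= tnth x i <= tnth b i].
(* [leb] is (Borel) Lebesgue measure on R^d: the measure giving every box its
   volume (this characterizes it uniquely on the Borel sets). *)
Definition is_lebesgue (leb : {measure set Rd -> \bar R}) : Prop :=
  forall a b : Rd, (forall i, tnth a i <= tnth b i) ->
    leb (box a b) = (\prod_(i < d) (tnth b i - tnth a i))%:E.

Definition law {dT} {Omega : measurableType dT} (P : probability Omega R)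
  (Z : Omega -> Rd) : set Rd -> \bar R := fun A => P (Z @^-1` A).

Definition is_density (leb : {measure set Rd -> \bar R})
  (m : set Rd -> \bar R) (f : Rd -> R) : Prop :=
  [/\ measurable_fun setT f, (forall x, 0 <= f x) &
      forall A, measurable A -> m A = (\int[leb]_(x in A) (f x)%:E)%E].

Definition independent {dT} {Omega : measurableType dT}
  (P : probability Omega R) (X Y : Omega -> Rd) : Prop :=
  forall A B : set Rd, measurable A -> measurable B ->
    P (X @^-1` A `&` Y @^-1` B) = (P (X @^-1` A) * P (Y @^-1` B))%E.

Definition charfun {dT} {Omega : measurableType dT}
  (P : probability Omega R) (V : Omega -> Rd) (w : Rd) : R[i] :=
  Complex (Rintegral P setT (fun o => cos (tdot w (V o))))
          (Rintegral P setT (fun o => sin (tdot w (V o)))).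

(* Every finite complex measure is (by Jordan decomposition)
   mu = (m1 - m2) + i (m3 - m4) with finite positive measures m1..m4. *)
Record cmeasure := CMeasure {
  cm_rpos : {finite_measure set Rd -> \bar R};
  cm_rneg : {finite_measure set Rd -> \bar R};
  cm_ipos : {finite_measure set Rd -> \bar R};
  cm_ineg : {finite_measure set Rd -> \bar R} }.

Definition cm_of (m : {finite_measure set Rd -> \bar R}) : cmeasure :=
  CMeasure m mzero mzero mzero.

Definition cint (mu : cmeasure) (h : Rd -> R[i]) : R[i] :=
  let a := fun x => creal (h x) in
  let b := fun x => cimag (h x) in
  let s (m : {finite_measure set Rd -> \bar R}) f := Rintegral m setT f in
  Complex ((s (cm_rpos mu) a - s (cm_rneg mu) a)
              - (s (cm_ipos mu) b - s (cm_ineg mu) b))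
          ((s (cm_rpos mu) b - s (cm_rneg mu) b)
              + (s (cm_ipos mu) a - s (cm_ineg mu) a)).

Definition C0fun (h : Rd -> R[i]) : Prop :=
  (forall (x : Rd) (e : R), 0 < e -> exists2 delta : R, 0 < delta &
      forall y, tnorm (tsub y x) < delta -> cnorm (h y - h x) < e) /\
  (forall e : R, 0 < e -> exists M : R, forall x, M < tnorm x -> cnorm (h x) < e).

Definition tvnorm (mu : cmeasure) : R :=
  sup [set r : R | exists h, [/\ C0fun h, (forall x, cnorm (h x) <= 1) &
                                 r = cnorm (cint mu h)]].

Definition Kconv (fV : Rd -> R) (mu : cmeasure) : Rd -> R[i] :=
  fun y => cint mu (fun x => (fV (tsub y x))%:C%C).

(* elements of A_V are L^1 classes: f in A_V iff f = f_V * mu Lebesgue-a.e. *)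
Definition inAV (leb : {measure set Rd -> \bar R}) (fV : Rd -> R)
  (f : Rd -> R[i]) : Prop :=
  exists mu : cmeasure, {ae leb, forall y, f y = Kconv fV mu y}.

(* ||f||_{A_V} = ||mu||_TV for the (unique, under the standing assumption)
   representing measure mu of f *)
Definition AVnorm (leb : {measure set Rd -> \bar R}) (fV : Rd -> R)
  (f : Rd -> R[i]) : R :=
  inf [set tvnorm mu | mu in [set mu | {ae leb, forall y, f y = Kconv fV mu y}]].

(* T is an element of A_V'(R^d): a functional on (L^1 classes of) A_V that is
   complex-linear and bounded (= continuous) for ||.||_{A_V}.  Values of T
   outside A_V are irrelevant. *)
Definition AVdual (leb : {measure set Rd -> \bar R}) (fV : Rd -> R)
  (T : (Rd -> R[i]) -> R[i]) : Prop :=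
  [/\ (forall f g, inAV leb fV f -> {ae leb, forall y, f y = g y} -> T f = T g),
      (forall f g (a b : R[i]), inAV leb fV f -> inAV leb fV g ->
          T (fun y => a * f y + b * g y) = a * T f + b * T g) &
      (exists C : R, forall f, inAV leb fV f ->
          cnorm (T f) <= C * AVnorm leb fV f)].

End Defs.

(* Main.v *)
Require Import Defs.
From HB Require Import structures.
From mathcomp Require Import all_boot all_order all_algebra.
From mathcomp Require Import all_classical all_reals all_analysis.
From mathcomp Require Import measurable_realfun complex.
From mathcomp Require Import ring lra.
Import Order.TTheory GRing.Theory Num.Theory.
Import numFieldNormedType.Exports.
Local Open Scope ring_scope.
Local Open Scope classical_set_scope.

Set Implicit Arguments.
Unset Strict Implicit.
Unset Printing Implicit Defensive.

(** The functional sends [f_V * mu] to the integral of [lambda] against [mu], so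
    everything rests on [mu] being determined by [f_V * mu].  If
    [f_V * p = f_V * q] a.e. for finite positive measures [p] and [q], their
    convolutions with [P_V] agree, so the characteristic functions of [p] and
    [q] agree wherever that of [V] does not vanish; this set is dense, so they
    agree everywhere by continuity.  Hence [p] and [q] have the same integrals
    of trigonometric polynomials.  To conclude that they agree on boxes, note
    that [(1 - ((1 + sin (y / L)) / 2) ^ K) ^ m], for suitable [L], [K], [m]
    tending to infinity, takes values in [[0, 1]] and converges to the indicator
    of [y <= 0] for every real [y]: products of such functions are trigonometric
    polynomials converging boundedly to the indicator of a box. *)

(** * Borel structure of the space of tuples *)

Section tuple_space.
Context {R : realType} {d : nat}.
Local Notation Rd := (d.-tuple R).
Implicit Types (w x y a b : Rd) (U : set Rd) (h : Rd -> R).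

Definition cst_tuple (c : R) : Rd := [tuple c | i < d].

Lemma taddC x y : tadd x y = tadd y x.
Proof. by apply: eq_from_tnth => i; rewrite !tnth_mktuple addrC. Qed.

Lemma tsubK x y : tadd (tsub x y) y = x.
Proof. by apply: eq_from_tnth => i; rewrite !tnth_mktuple subrK. Qed.

Lemma tdotDr w x y : tdot w (tadd x y) = tdot w x + tdot w y.
Proof.
by rewrite -big_split; apply: eq_bigr => i _; rewrite tnth_mktuple mulrDr.
Qed.

Lemma tdotDl w w' x : tdot (tadd w w') x = tdot w x + tdot w' x.
Proof.
by rewrite -big_split; apply: eq_bigr => i _; rewrite tnth_mktuple mulrDl.
Qed.

Lemma tnorm_ge0 x : 0 <= tnorm x.
Proof.
by rewrite /tnorm; elim/big_ind : _ => // r s r0 s0; rewrite le_max r0.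
Qed.

Lemma norm_tnth_le x i : `|tnth x i| <= tnorm x.
Proof. by rewrite /tnorm (bigD1 i)//= le_max lexx. Qed.

Lemma tnorm_lt x (e : R) : 0 < e ->
  (forall i, `|tnth x i| < e) -> tnorm x < e.
Proof.
move=> e0 xe; rewrite /tnorm.
by elim/big_ind : _ => // r s re se; rewrite gt_max re.
Qed.

Lemma measurable_mktuple {dT} {T : measurableType dT} (f : 'I_d -> T -> R) :
  (forall i, measurable_fun setT (f i)) ->
  measurable_fun setT (fun t => [tuple f i t | i < d] : Rd).
Proof.
move=> mf; apply/measurable_fun_tnthP => i.
by rewrite (_ : _ \o _ = f i)//; apply/funext => t /=; rewrite tnth_mktuple.
Qed.

Lemma measurable_tadd :
  measurable_fun setT (fun z : Rd * Rd => tadd z.1 z.2).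
Proof.
apply: measurable_mktuple => i.
by apply: measurable_funD; apply: (measurableT_comp (measurable_tnth i)).
Qed.

Lemma measurable_tsub :
  measurable_fun setT (fun z : Rd * Rd => tsub z.1 z.2).
Proof.
apply: measurable_mktuple => i.
by apply: measurable_funB; apply: (measurableT_comp (measurable_tnth i)).
Qed.

Lemma measurable_tdot w : measurable_fun setT (tdot w).
Proof.
apply: measurable_sum => i; apply: measurable_funM => //.
exact: measurable_tnth.
Qed.

Lemma measurable_box a b : measurable (box a b).
Proof.
rewrite (_ : box a b =
    \bigcap_(i in setT) ((@tnth d R)^~ i @^-1` `[tnth a i, tnth b i])).
  apply: fin_bigcap_measurable => [|i _]; first exact: finite_finset.
  by rewrite -[X in measurable X]setTI; apply: measurable_tnth.
apply/seteqP; split=> x /= xab i; first by move=> _; rewrite /= in_itv/=.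
by have := xab i I; rewrite /= in_itv.
Qed.

Definition boxes : set (set Rd) := [set A | exists a b, A = box a b].

Lemma boxes_setI_closed : setI_closed boxes.
Proof.
move=> _ _ [a [b ->]] [a' [b' ->]].
exists [tuple Num.max (tnth a i) (tnth a' i) | i < d].
exists [tuple Num.min (tnth b i) (tnth b' i) | i < d].
apply/seteqP; split=> x /=.
  move=> [xab xab'] i; rewrite !tnth_mktuple ge_max le_min.
  by have /andP[-> ->] := xab i; have /andP[-> ->] := xab' i.
move=> xab; split=> i; have := xab i; rewrite !tnth_mktuple ge_max le_min.
  by move=> /andP[/andP[-> _] /andP[-> _]].
by move=> /andP[/andP[_ ->] /andP[_ ->]].
Qed.

Definition cube (n : nat) : set Rd := box (cst_tuple (- n%:R)) (cst_tuple n%:R).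

Lemma boxes_cube n : boxes (cube n).
Proof. by eexists; eexists. Qed.

Lemma bigcup_cube : \bigcup_n cube n = setT.
Proof.
apply/seteqP; split=> // x _.
exists (Num.bound (tnorm x)) => // i; rewrite !tnth_mktuple -ler_norml.
exact: le_trans (norm_tnth_le x i) (ltW (archi_boundP (tnorm_ge0 x))).
Qed.

Lemma measurable_boxes : @measurable _ Rd = <<s boxes >>.
Proof.
apply/seteqP; split; last first.
  apply: smallest_sub; first exact: sigma_algebra_measurable.
  by move=> _ [a [b ->]]; exact: measurable_box.
apply: smallest_sub; first exact: smallest_sigma_algebra.
move=> A; rewrite -bigcup_seq/= => -[i _] [B mB <-].
pose coord : g_sigma_algebraType boxes -> R := fun x => tnth x i.
suff mcoord : measurable_fun setT coord by exact: (mcoord measurableT B mB).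
apply: (measurability _ (RGenCInfty.measurableE R)) => _ [_ [c ->] <-].
rewrite setTI [X in measurable X](_ : _ = \bigcup_n
   box [tuple (if j == i then c else - n%:R) | j < d] (cst_tuple n%:R)).
  apply: bigcup_measurable => n _.
  by apply: sub_sigma_algebra; eexists; eexists.
apply/seteqP; split=> y /=; last first.
  by move=> [n _ /(_ i)]; rewrite !tnth_mktuple eqxx in_itv/= => /andP[->].
rewrite in_itv/= andbT => cy.
have : setT y by [].
rewrite -bigcup_cube => -[n _ yn]; exists n => // j; have := yn j.
by rewrite !tnth_mktuple => /andP[? ->]; rewrite andbT; case: eqP => // ->.
Qed.

Definition topen U := forall x, U x ->
  exists2 delta : R, 0 < delta & forall y, tnorm (tsub y x) < delta -> U y.

Definition tcontinuous h := forall x (e : R), 0 < e ->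
  exists2 delta : R, 0 < delta &
    forall y, tnorm (tsub y x) < delta -> `|h y - h x| < e.

Lemma topen_measurable U : topen U -> measurable U.
Proof.
move=> oU.
pose rat_box (z : d.-tuple rat * d.-tuple rat) : set Rd :=
  box (map_tuple ratr z.1) (map_tuple ratr z.2).
rewrite (_ : U = \bigcup_z
    (if pselect (rat_box z `<=` U) then rat_box z else set0)).
  apply: countable_bigcupT_measurable => // z.
  by case: pselect => //= _; exact: measurable_box.
apply/seteqP; split=> [x Ux|x [z _]]; last first.
  by case: pselect => //= zU; exact: zU.
have [delta delta0 xU] := oU _ Ux.
have rat_between (r s : R) : r < s -> exists q : rat, r < ratr q < s.
  by move=> /rat_in_itvoo[q]; rewrite in_itv/= => rqs; exists q.
have [lo loP] := fin_all_exists (fun i =>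
  rat_between (tnth x i - delta / 2) (tnth x i) ltac:(lra)).
have [up upP] := fin_all_exists (fun i =>
  rat_between (tnth x i) (tnth x i + delta / 2) ltac:(lra)).
exists ([tuple lo i | i < d], [tuple up i | i < d]) => //.
case: pselect => /= [_ i|[]].
  rewrite !tnth_map !tnth_ord_tuple.
  by have := loP i; have := upP i; lra.
move=> y yz; apply: xU; apply: tnorm_lt => // i; have := yz i.
rewrite !(tnth_map, tnth_ord_tuple) ltr_norml.
by have := loP i; have := upP i; lra.
Qed.

Lemma tcontinuous_measurable h : tcontinuous h -> measurable_fun setT h.
Proof.
move=> hc.
apply: (measurability _ (RGenOInfty.measurableE R)) => _ [_ [c ->] <-].
rewrite setTI; apply: topen_measurable => x /=; rewrite in_itv/= andbT => cx.
have [delta delta0 xh] := hc x (h x - c) ltac:(by rewrite subr_gt0).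
exists delta => // y /xh; rewrite in_itv/= andbT ltr_norml; lra.
Qed.

Lemma tcontinuous_bounded h (L : R) : tcontinuous h ->
  exists M, forall x, tnorm x <= L -> `|h x| <= M.
Proof.
move=> hc.
pose K := [set v : 'rV[R]_d | forall i, `[- L, L] (v ord0 i)].
have K_compact : compact K.
  apply: (@rV_compact _ _ (fun=> `[- L, L]%classic)) => _.
  exact: segment_compact.
pose g (v : 'rV[R]_d) : R := h [tuple v ord0 i | i < d].
have g_continuous : continuous g.
  move=> v; apply/(@cvgrPdist_lt _ _ _ (nbhs v) (nbhs_filter v)) => e e0.
  have [delta delta0 hv] := hc [tuple v ord0 i | i < d] e e0.
  exists (fun i j => ball (v i j) delta) => [i j|v' vv'] /=.
    exact: nbhsx_ballx.
  rewrite distrC; apply: hv; apply: tnorm_lt => // i.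
  by rewrite !tnth_mktuple distrC; exact: vv'.
have /compact_bounded[M [_ /(_ (M + 1))]] :=
  continuous_compact (continuous_subspaceT g_continuous) K_compact.
rewrite ltrDl => /(_ ltr01) gM; exists (M + 1) => x xL.
apply: gM; exists (\row_i tnth x i).
  by move=> i /=; rewrite mxE in_itv/= -ler_norml (le_trans (norm_tnth_le _ _)).
by rewrite /g; congr h; apply: eq_from_tnth => i; rewrite tnth_mktuple mxE.
Qed.

End tuple_space.

(** * Lebesgue measure *)

Section lebesgue.
Context {R : realType} {d : nat}.
Local Notation Rd := (d.-tuple R).
Variable leb : {measure set Rd -> \bar R}.
Hypothesis lebP : is_lebesgue leb.

Lemma is_lebesgue_box (a b : Rd) :
  leb (box a b) = (\prod_(i < d) Num.max 0 (tnth b i - tnth a i))%:E.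
Proof.
have [ab|/existsNP[i /negP]] := pselect (forall i, tnth a i <= tnth b i).
  rewrite lebP//; congr EFin; apply: eq_bigr => i _.
  by rewrite max_r// subr_ge0.
rewrite -ltNge => ba; rewrite (bigD1 i)//= max_l ?mul0r; last first.
  by rewrite subr_le0 ltW.
rewrite (_ : box a b = set0) ?measure0//; apply/seteqP; split=> // x /(_ i).
by move=> /andP[/le_trans] /[apply]; rewrite leNgt ba.
Qed.

Lemma is_lebesgue_sigma_finite : sigma_finite setT leb.
Proof.
exists cube; first by rewrite bigcup_cube.
by move=> n; split; [exact: measurable_box|rewrite is_lebesgue_box ltry].
Qed.

Lemma measurable_translation (x : Rd) :
  measurable_fun setT (tsub^~ x : Rd -> Rd).
Proof. exact: (measurableT_comp measurable_tsub (pair2_measurable x)). Qed.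

Lemma is_lebesgue_translation (x : Rd) (A : set Rd) : measurable A ->
  leb ((tsub^~ x) @^-1` A) = leb A.
Proof.
move=> mA; apply/esym.
pose translated : {measure set Rd -> \bar R} := pushforward leb (tsub^~ x).
apply: (measure_unique _ _ measurable_boxes boxes_setI_closed boxes_cube
  bigcup_cube leb (translated (measurable_translation x)))
  => // [_ [a [b ->]]|n]; last first.
  by rewrite is_lebesgue_box ltry.
rewrite /translated/= /pushforward.
have -> : tsub^~ x @^-1` box a b = box (tadd a x) (tadd b x).
  apply/seteqP; split=> y yab i; have := yab i; rewrite !tnth_mktuple.
    by rewrite lerBrDr lerBlDr.
  by rewrite lerBrDr lerBlDr.
rewrite !is_lebesgue_box; congr EFin; apply: eq_bigr => i _.
by rewrite !tnth_mktuple [in RHS]opprD addrACA subrr addr0.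
Qed.

Lemma ge0_integral_translation (x : Rd) (g : Rd -> \bar R) :
  measurable_fun setT g -> (forall y, 0 <= g y)%E ->
  (\int[leb]_y g (tsub y x) = \int[leb]_y g y)%E.
Proof.
move=> mg g0.
have := @ge0_integral_pushforward _ _ _ _ _ _ (measurable_translation x) leb
  setT g measurableT mg (fun y _ => g0 y).
rewrite preimage_setT => <-.
apply: eq_measure_integral => [|mt A mA _]; first exact: measurable_translation.
exact: is_lebesgue_translation.
Qed.

(* Every nonempty open box has positive measure, so an almost everywhere
   property holds along some sequence converging to any given point. *)
Lemma is_lebesgue_ae_dense (Q : Rd -> Prop) : {ae leb, forall w, Q w} ->
  forall w : Rd, exists2 w_ : nat -> Rd, forall n, Q (w_ n) &
    forall i, (fun n => tnth (w_ n) i) @ \oo --> tnth w i.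
Proof.
move=> [N [mN N0 QN]] w.
have near_w n : exists v, box w (tadd w (cst_tuple n.+1%:R^-1)) v /\ Q v.
  apply: contrapT => /forallNP noQ.
  have : (leb (box w (tadd w (cst_tuple n.+1%:R^-1))) <= leb N)%E.
    apply: le_measure; rewrite ?inE//; first exact: measurable_box.
    by move=> v vb; apply: QN => /= Qv; exact: (noQ v).
  rewrite N0 is_lebesgue_box lee_fin leNgt prodr_gt0// => i _.
  by rewrite !tnth_mktuple addrAC subrr add0r lt_max invr_gt0 ltr0n orbT.
have [w_ w_P] := choice near_w.
exists w_ => [n|i]; first by have [] := w_P n.
apply: (@squeeze_cvgr _ _ _ _ (fun=> tnth w i)
  (fun n => tnth w i + n.+1%:R^-1)).
- by near=> n; have [/(_ i)+ _] := w_P n; rewrite !tnth_mktuple.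
- exact: cvg_cst.
- rewrite -[X in _ --> X]addr0; apply: cvgD; first exact: cvg_cst.
  exact: cvg_harmonic.
Unshelve. all: by end_near. Qed.

End lebesgue.

(** * Integrals of complex-valued functions *)

Section complex_numbers.
Context {R : realType}.
Implicit Types z : R[i].

Lemma complex_ext z z' : creal z = creal z' -> cimag z = cimag z' -> z = z'.
Proof. by case: z => a b; case: z' => a' b' /= -> ->. Qed.

Lemma crealD z z' : creal (z + z') = creal z + creal z'.
Proof. by case: z; case: z'. Qed.

Lemma cimagD z z' : cimag (z + z') = cimag z + cimag z'.
Proof. by case: z; case: z'. Qed.

Lemma crealB z z' : creal (z - z') = creal z - creal z'.
Proof. by case: z; case: z'. Qed.

Lemma cimagB z z' : cimag (z - z') = cimag z - cimag z'.
Proof. by case: z; case: z'. Qed.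

Lemma crealM z z' : creal (z * z') = creal z * creal z' - cimag z * cimag z'.
Proof. by case: z; case: z'. Qed.

Lemma cimagM z z' : cimag (z * z') = creal z * cimag z' + cimag z * creal z'.
Proof. by case: z; case: z'. Qed.

Lemma cnormE z : cnorm z = Num.sqrt (creal z ^+ 2 + cimag z ^+ 2).
Proof. by case: z. Qed.

Lemma cnorm_ge0 z : 0 <= cnorm z.
Proof. by rewrite cnormE sqrtr_ge0. Qed.

Lemma norm_creal_le z : `|creal z| <= cnorm z.
Proof. by rewrite cnormE -sqrtr_sqr ler_wsqrtr// lerDl sqr_ge0. Qed.

Lemma norm_cimag_le z : `|cimag z| <= cnorm z.
Proof. by rewrite cnormE -sqrtr_sqr ler_wsqrtr// lerDr sqr_ge0. Qed.

Lemma cnorm_le_sum z : cnorm z <= `|creal z| + `|cimag z|.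
Proof.
rewrite cnormE -[leRHS]ger0_norm ?addr_ge0// -sqrtr_sqr ler_wsqrtr//.
rewrite -(real_normK (num_real (creal z))) -(real_normK (num_real (cimag z))).
by rewrite sqrrD lerD2r lerDl mulrn_wge0// mulr_ge0.
Qed.

Lemma cnormM z z' : cnorm (z * z') = cnorm z * cnorm z'.
Proof. exact: Normc.normcM. Qed.

Lemma cnormD z z' : cnorm (z + z') <= cnorm z + cnorm z'.
Proof. by have := ler_normD z z'; rewrite -rmorphD/= lecR. Qed.

Lemma cnormN z : cnorm (- z) = cnorm z.
Proof. by rewrite !cnormE; case: z => a b /=; rewrite !sqrrN. Qed.

Lemma cnorm_real (a : R) : cnorm a%:C%C = `|a|.
Proof. by rewrite cnormE/= expr0n addr0 sqrtr_sqr. Qed.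

Lemma cnorm_i : cnorm 'i%C = 1 :> R.
Proof. by rewrite cnormE/= expr0n expr1n add0r sqrtr1. Qed.

End complex_numbers.

Lemma EFin_Rintegral {dT} {T : measurableType dT} {R : realType}
    (m : {measure set T -> \bar R}) (f : T -> R) :
  m.-integrable setT (EFin \o f) ->
  (\int[m]_x f x)%:E = (\int[m]_x (f x)%:E)%E.
Proof. by move=> fi; rewrite /Rintegral fineK//; exact: integrable_fin_num. Qed.

Section bounded_integrals.
Context {dT} {T : measurableType dT} {R : realType}.
Variable m : {finite_measure set T -> \bar R}.

Lemma finite_measure_lty : (m setT < +oo)%E.
Proof. by rewrite ltey_eq fin_num_measure. Qed.

Lemma bounded_integrable (f : T -> R) M : measurable_fun setT f ->
  (forall x, `|f x| <= M) -> m.-integrable setT (EFin \o f).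
Proof.
move=> mf fM; apply: measurable_bounded_integrable => //.
  exact: finite_measure_lty.
exists M; split; first exact: num_real.
by move=> N MN x _ /=; rewrite (le_trans (fM x))// ltW.
Qed.

Lemma bounded_Rintegral_cvg (f_ : (T -> R)^nat) (f : T -> R) M :
  (forall n, measurable_fun setT (f_ n)) -> (forall n x, `|f_ n x| <= M) ->
  (forall x, f_ ^~ x @ \oo --> f x) ->
  (fun n => \int[m]_x f_ n x) @ \oo --> \int[m]_x f x.
Proof.
move=> mf_ fM f_cvg; have mf : measurable_fun setT f.
  by apply: (measurable_fun_cvg mf_) => x _; exact: f_cvg.
have M_integrable : m.-integrable setT (EFin \o cst M).
  by apply: (@bounded_integrable _ `|M|).
have [] := @dominated_convergence _ _ _ m setT measurableT
  (fun n => EFin \o f_ n) (EFin \o f) (EFin \o cst M).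
- by move=> n; exact/measurable_EFinP.
- exact/measurable_EFinP.
- by apply: aeW => x _; apply: cvg_EFin; [exact: nearW|exact: f_cvg].
- exact: M_integrable.
- by apply: aeW => x n _ /=; rewrite lee_fin.
move=> fi _ integral_cvg.
have : (fun n => (\int[m]_x f_ n x)%:E) @ \oo --> (\int[m]_x f x)%:E.
  rewrite (EFin_Rintegral fi).
  rewrite (_ : (fun n => _) = (fun n => \int[m]_x (f_ n x)%:E)%E)//.
  apply/funext => n; rewrite /= EFin_Rintegral//.
  exact: bounded_integrable (fM n).
by move=> /fine_cvg.
Qed.

Lemma norm_Rintegral_le (f : T -> R) M : m.-integrable setT (EFin \o f) ->
  (forall x, `|f x| <= M) -> `|\int[m]_x f x| <= M * fine (m setT).
Proof.
move=> fi fM; rewrite (le_trans (le_normr_Rintegral _ _))//.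
rewrite -Rintegral_cst//; apply: le_Rintegral => //.
- exact: integrable_norm.
- exact: (@bounded_integrable _ `|M|).
Qed.

End bounded_integrals.

Section finite_measure_operations.
Context {dT} {T : measurableType dT} {R : realType}.

Section addition.
Variables p q : {finite_measure set T -> \bar R}.

Definition fmadd : set T -> \bar R := measure_add p q.

HB.instance Definition _ := Measure.on fmadd.

Let fmadd_fin : fin_num_fun fmadd.
Proof.
by move=> A mA; rewrite /fmadd measure_addE fin_numD !fin_num_measure.
Qed.

HB.instance Definition _ := Measure_isFinite.Build _ T R fmadd fmadd_fin.

Lemma Rintegral_fmadd f : p.-integrable setT (EFin \o f) ->
  q.-integrable setT (EFin \o f) ->
  \int[fmadd]_x f x = (\int[p]_x f x) + (\int[q]_x f x).
Proof.
move=> pf qf; rewrite /Rintegral integral_measure_add// fineD//;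
  exact: integrable_fin_num.
Qed.

End addition.

Lemma Rintegral_mscale (k : {nonneg R}) (m : {measure set T -> \bar R}) f :
  m.-integrable setT (EFin \o f) ->
  \int[mscale k m]_x f x = k%:num * \int[m]_x f x.
Proof.
move=> fi.
have f_pos := integrable_funepos measurableT fi.
have f_neg := integrable_funeneg measurableT fi.
have f_measurable := measurable_int _ fi.
rewrite /Rintegral integralE [in RHS]integralE.
rewrite !ge0_integral_mscale//;
  [|exact: measurable_funeneg|exact: measurable_funepos].
rewrite -muleBr// ?fineM//.
- by rewrite fin_numB !integrable_fin_num.
- by apply: fin_num_adde_defr; exact: integrable_fin_num.
Qed.

End finite_measure_operations.

Section complex_integrals.
Context {dT} {T : measurableType dT} {R : realType}.
Implicit Types (m : {measure set T -> \bar R}) (f g : T -> R[i]).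

Definition Cintegrable m f :=
  m.-integrable setT (EFin \o (fun x => creal (f x))) /\
  m.-integrable setT (EFin \o (fun x => cimag (f x))).

Definition Cintegral m f : R[i] :=
  Complex (\int[m]_x creal (f x)) (\int[m]_x cimag (f x)).

Lemma bounded_Cintegrable (p : {finite_measure set T -> \bar R}) f M :
  measurable_fun setT (fun x => creal (f x)) ->
  measurable_fun setT (fun x => cimag (f x)) ->
  (forall x, cnorm (f x) <= M) -> Cintegrable p f.
Proof.
move=> mr mi fM; split; apply: (bounded_integrable _ (M := M)) => // x.
  by rewrite (le_trans (norm_creal_le _)).
by rewrite (le_trans (norm_cimag_le _)).
Qed.

Lemma CintegrableD m f g : Cintegrable m f -> Cintegrable m g ->
  Cintegrable m (fun x => f x + g x).
Proof.
move=> [fr fi] [gr gi]; split.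
- by under [_ \o _]eq_fun do rewrite /= crealD EFinD; exact: integrableD.
- by under [_ \o _]eq_fun do rewrite /= cimagD EFinD; exact: integrableD.
Qed.

Lemma CintegralD m f g : Cintegrable m f -> Cintegrable m g ->
  Cintegral m (fun x => f x + g x) = Cintegral m f + Cintegral m g.
Proof.
move=> [fr fi] [gr gi]; apply: complex_ext => /=; rewrite -RintegralD//.
- by apply: eq_Rintegral => x _; rewrite crealD.
- by apply: eq_Rintegral => x _; rewrite cimagD.
Qed.

Let integrable_scaled m (k : R) (h : T -> R) : m.-integrable setT (EFin \o h) ->
  m.-integrable setT (EFin \o (fun x => k * h x)).
Proof.
by move=> hi; under [_ \o _]eq_fun do rewrite /= EFinM; exact: integrableZl.
Qed.

Lemma CintegrableZ m (a : R[i]) f : Cintegrable m f ->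
  Cintegrable m (fun x => a * f x).
Proof.
move=> [fr fi]; split.
- under [_ \o _]eq_fun do rewrite /= crealM EFinB.
  by apply: integrableB => //; exact: integrable_scaled.
- under [_ \o _]eq_fun do rewrite /= cimagM EFinD.
  by apply: integrableD => //; exact: integrable_scaled.
Qed.

Lemma CintegralZ m (a : R[i]) f : Cintegrable m f ->
  Cintegral m (fun x => a * f x) = a * Cintegral m f.
Proof.
move=> [fr fi]; apply: complex_ext; rewrite ?crealM ?cimagM/= -!RintegralZl//.
- rewrite -RintegralB//; [|exact: integrable_scaled..].
  by apply: eq_Rintegral => x _; rewrite crealM.
- rewrite -RintegralD//; [|exact: integrable_scaled..].
  by apply: eq_Rintegral => x _; rewrite cimagM.
Qed.

Lemma Cintegral_real m (h : T -> R) :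
  Cintegral m (fun x => (h x)%:C%C) = (\int[m]_x h x)%:C%C.
Proof. by apply: complex_ext => //=; rewrite Rintegral_cst// mul0r. Qed.

Lemma Cintegral_fmadd (p q : {finite_measure set T -> \bar R}) f :
  Cintegrable p f -> Cintegrable q f ->
  Cintegral (fmadd p q) f = Cintegral p f + Cintegral q f.
Proof. by move=> [? ?] [? ?]; rewrite /Cintegral !Rintegral_fmadd. Qed.

Lemma Cintegral_mscale (k : {nonneg R}) m f : Cintegrable m f ->
  Cintegral (mscale k m) f = k%:num%:C%C * Cintegral m f.
Proof.
move=> [? ?]; rewrite /Cintegral !Rintegral_mscale//.
by apply: complex_ext; rewrite ?crealM ?cimagM/=; ring.
Qed.

Lemma eq_measure_Cintegral m m' f : (forall A, measurable A -> m A = m' A) ->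
  Cintegral m f = Cintegral m' f.
Proof.
by move=> mm'; congr Complex; congr fine; apply: eq_measure_integral => A mA _;
  exact: mm'.
Qed.

Lemma cnorm_Cintegral_le (p : {finite_measure set T -> \bar R}) f M :
  Cintegrable p f -> (forall x, cnorm (f x) <= M) ->
  cnorm (Cintegral p f) <= (M * fine (p setT)) *+ 2.
Proof.
move=> [fr fi] fM; rewrite (le_trans (cnorm_le_sum _))// mulr2n lerD//=.
- by apply: norm_Rintegral_le => // x; rewrite (le_trans (norm_creal_le _)).
- by apply: norm_Rintegral_le => // x; rewrite (le_trans (norm_cimag_le _)).
Qed.

End complex_integrals.

Lemma Cintegral_image {dT dU} {T : measurableType dT} {U : measurableType dU}
    {R : realType} (phi : T -> U) (m : {measure set T -> \bar R})
    (nu : {measure set U -> \bar R}) (f : U -> R[i]) :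
  measurable_fun setT phi ->
  (forall A, measurable A -> nu A = m (phi @^-1` A)) ->
  measurable_fun setT (fun x => creal (f x)) ->
  measurable_fun setT (fun x => cimag (f x)) ->
  Cintegrable m (f \o phi) -> Cintegral nu f = Cintegral m (f \o phi).
Proof.
move=> mphi nuE mr mi [ir ii].
have Rintegral_image (h : U -> R) : measurable_fun setT h ->
    m.-integrable setT (EFin \o (h \o phi)) ->
    \int[nu]_x h x = \int[m]_x h (phi x).
  move=> mh hi; congr fine; rewrite (eq_measure_integral (pushforward m phi)).
    by rewrite (integral_pushforward mphi)//; exact/measurable_EFinP.
  by move=> A mA _; exact: nuE.
by congr Complex; apply: Rintegral_image.
Qed.

(** * Trigonometric approximation of the indicator of a box *)

Section sine_step.
Context {R : realType}.
Implicit Types (x y t : R) (n m : nat).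

Lemma bernoulli_ineq t m : -1 <= t -> 1 + m%:R * t <= (1 + t) ^+ m.
Proof.
move=> t1; elim: m => [|m IH]; first by rewrite mul0r addr0 expr0.
have t1' : 0 <= 1 + t by lra.
rewrite exprSr; apply: le_trans (ler_wpM2r t1' IH).
have mt : 0 <= m%:R * t ^+ 2 :> R by rewrite mulr_ge0 ?sqr_ge0.
by rewrite -natr1; move: mt; rewrite expr2; nra.
Qed.

Lemma onem_expr_le_inv t m : 0 < t <= 1 -> (0 < m)%N ->
  (1 - t) ^+ m <= (m%:R * t)^-1.
Proof.
move=> /andP[t0 t1] m0; have mt0 : 0 < m%:R * t by rewrite mulr_gt0// ltr0n.
apply: (@le_trans _ _ (expR (- t) ^+ m)).
  by rewrite lerXn2r ?nnegrE ?subr_ge0 ?expR_ge0// expR_ge1Dx.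
rewrite -expRM_natl mulrN expRN lef_pV2 ?posrE ?expR_gt0//.
by apply: le_trans (expR_ge1Dx _); rewrite lerDr.
Qed.

Lemma sin_ge_cos1M x : 0 <= x <= 1 -> cos 1 * x <= sin x.
Proof.
move=> /andP[x0 x1]; have p2 := pi_ge2 R.
have [c] := @MVT_segment R sin cos 0 x x0 (fun y _ => is_derive_sin y)
  (continuous_subspaceT (@continuous_sin R)).
rewrite in_itv/= sin0 !subr0 => /andP[c0 cx] ->; rewrite ler_wpM2r//.
have [->//|c1] := eqVneq c 1.
by rewrite ltW// ltr_cos ?in_itv/= ?lt_neqAle ?c1//; apply/andP; split; lra.
Qed.

(* For [|y| <= 2 ^ n] the inner base is at most 1/2 if [y <= 0], and exceeds 1/2
   by about [y / 2 ^ n] if [0 < y].  Multiplying its [8 ^ n]-th power by the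
   outer exponent thus gives at most [2 ^ - n] in the first case and at least a
   multiple of [2 ^ n * y] in the second. *)
Definition sine_step n y : R :=
  (1 - ((1 + sin (y / 2 ^+ n)) / 2) ^+ (8 ^ n)) ^+ (2 ^ (8 ^ n - n)).

Let sine_base_itv t : 0 <= (1 + sin t) / 2 <= 1.
Proof. by have := sin_geN1 t; have := sin_le1 t; lra. Qed.

Let sine_base_expr_itv t m : 0 <= ((1 + sin t) / 2) ^+ m <= 1.
Proof.
by have /andP[? ?] := sine_base_itv t; rewrite exprn_ge0// exprn_ile1.
Qed.

Lemma sine_step_itv n y : 0 <= sine_step n y <= 1.
Proof.
have /andP[u0 u1] := sine_base_expr_itv (y / 2 ^+ n) (8 ^ n).
by rewrite /sine_step exprn_ge0 ?exprn_ile1//; lra.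
Qed.

Let outer_exponentM n t :
  (2 ^ (8 ^ n - n))%:R * (t / 2) ^+ (8 ^ n) = t ^+ (8 ^ n) / 2 ^+ n.
Proof.
have n8 : (n <= 8 ^ n)%N by rewrite ltnW// ltn_expl.
rewrite exprMn exprVn mulrCA natrX; congr (_ * _).
by rewrite -[in X in _ / X](subnK n8) exprD invfM mulrA divff ?mul1r//.
Qed.

Lemma sine_step_ge n y : - 2 ^+ n <= y <= 0 -> 1 - 2 ^- n <= sine_step n y.
Proof.
move=> /andP[yn y0]; have p2 := pi_ge2 R.
have e0 : 0 < 2 ^+ n :> R by rewrite exprn_gt0.
have sin_le0 : sin (y / 2 ^+ n) <= 0.
  rewrite -oppr_ge0 -sinN sin_ge0_pi// -mulNr.
  by rewrite divr_ge0 ?oppr_ge0 ?(ltW e0)//= ler_pdivrMr//; nra.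
have /andP[u0 u1] := sine_base_expr_itv (y / 2 ^+ n) (8 ^ n).
have := @bernoulli_ineq (- ((1 + sin (y / 2 ^+ n)) / 2) ^+ (8 ^ n))
  (2 ^ (8 ^ n - n)) ltac:(lra).
apply: le_trans; rewrite mulrN outer_exponentM lerD2l lerN2.
by rewrite ler_piMl ?invr_ge0 ?(ltW e0)// exprn_ile1 ?gerDl.
Qed.

Lemma sine_step_le n y : 0 < y <= 2 ^+ n ->
  sine_step n y <= (cos 1 * y)^-1 * 2 ^- n.
Proof.
move=> /andP[y0 yn]; have c0 := cos1_gt0 R.
have e0 : 0 < 2 ^+ n :> R by rewrite exprn_gt0.
rewrite /sine_step; set s := sin (y / 2 ^+ n).
have s_ge : cos 1 * (y / 2 ^+ n) <= s.
  by rewrite sin_ge_cos1M// divr_ge0 ?(ltW y0) ?(ltW e0)//= ler_pdivrMr// mul1r.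
have s0 : 0 < s by apply: lt_le_trans s_ge; rewrite mulr_gt0// divr_gt0.
have s1 : 0 < 1 + s by rewrite addr_gt0.
have growth : cos 1 * y * 2 ^+ n <= (1 + s) ^+ (8 ^ n) / 2 ^+ n.
  rewrite ler_pdivlMr//; apply: le_trans (bernoulli_ineq _ (sin_geN1 _)).
  apply: (@le_trans _ _ ((8 ^ n)%:R * (cos 1 * (y / 2 ^+ n)))); last first.
    by rewrite ler_wpDl// ler_wpM2l.
  rewrite natrX (_ : 8%:R = 2 * 2 * 2 :> R); last by ring.
  suff -> : (2 * 2 * 2) ^+ n * (cos 1 * (y / 2 ^+ n)) =
    cos 1 * y * 2 ^+ n * 2 ^+ n by [].
  by rewrite !exprMn; field; rewrite gt_eqF.
have u0 : 0 < ((1 + s) / 2) ^+ (8 ^ n) by rewrite exprn_gt0// divr_gt0.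
have /andP[_ u1] := sine_base_expr_itv (y / 2 ^+ n) (8 ^ n).
apply: (le_trans (onem_expr_le_inv _ _)); rewrite ?expn_gt0//.
  by rewrite u0.
rewrite outer_exponentM -invfM lef_pV2 ?posrE//.
  by rewrite divr_gt0// exprn_gt0.
by rewrite !mulr_gt0.
Qed.

Lemma sine_step_cvg y : sine_step ^~ y @ \oo --> ((y <= 0)%R%:R : R).
Proof.
have halfX_cvg : (fun n => 2 ^- n : R) @ \oo --> (0 : R).
  under eq_fun do rewrite -exprVn.
  by apply: cvg_expr; rewrite ger0_norm ?invr_ge0// invf_lt1// ltr1n.
have y_bounded : \forall n \near \oo, `|y| <= 2 ^+ n.
  exists (Num.bound `|y|) => // n /= yn.
  apply: le_trans (ltW (archi_boundP (normr_ge0 y))) _.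
  by rewrite -natrX ler_nat (leq_trans yn)// ltnW// ltn_expl.
have [y0|y0] := leP y 0.
  apply: (@squeeze_cvgr _ _ _ _ (fun n => 1 - 2 ^- n) (fun=> 1)).
  - near=> n; have /andP[_ ->] := sine_step_itv n y; rewrite andbT.
    rewrite sine_step_ge// y0 andbT lerNl (le_trans (ler_norm _))// normrN.
    by near: n.
  - by rewrite -[X in _ --> X]subr0; apply: cvgB => //; exact: cvg_cst.
  - exact: cvg_cst.
apply: (@squeeze_cvgr _ _ _ _ (fun=> 0) (fun n => (cos 1 * y)^-1 * 2 ^- n)).
- near=> n; have /andP[-> _] := sine_step_itv n y.
  rewrite sine_step_le// y0 (le_trans (ler_norm _))//.
  by near: n.
- exact: cvg_cst.
- by rewrite -[X in _ --> X](mulr0 (cos 1 * y)^-1); exact: cvgMr.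
Unshelve. all: by end_near. Qed.

End sine_step.

Section box_step.
Context {R : realType} {d : nat}.
Local Notation Rd := (d.-tuple R).
Implicit Types (a b x : Rd) (n : nat).

Definition box_step a b n x : R := \prod_(i < d)
  (sine_step n (tnth x i - tnth b i) * sine_step n (tnth a i - tnth x i)).

Lemma norm_box_step_le1 a b n x : `|box_step a b n x| <= 1.
Proof.
rewrite /box_step normr_prod; apply: prodr_ile1 => i _.
rewrite normr_ge0/= normrM.
have /andP[? ?] := sine_step_itv n (tnth x i - tnth b i).
have /andP[? ?] := sine_step_itv n (tnth a i - tnth x i).
by rewrite !ger0_norm// mulr_ile1.
Qed.

Lemma box_step_cvg a b x :
  (fun n => box_step a b n x) @ \oo --> (\1_(box a b) x : R).
Proof.
rewrite (_ : \1_(box a b) x = \prod_(i < d)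
    ((tnth x i - tnth b i <= 0)%R%:R * (tnth a i - tnth x i <= 0)%R%:R)).
  apply: cvg_big => [|i _]; first exact: mul_continuous.
  by apply: cvgM; exact: sine_step_cvg.
rewrite indicE; have [xab|xab] := asboolP (box a b x).
  rewrite mem_set// big1// => i _; have /andP[ax xb] := xab i.
  by rewrite !subr_le0 ax xb mulr1.
rewrite memNset//; move: xab => /existsNP[i /negP]; rewrite negb_and => xab.
rewrite (bigD1 i)//= !subr_le0.
by case/orP: xab => /negbTE ->; rewrite ?mulr0 ?mul0r.
Qed.

End box_step.

Section trigonometric_polynomials.
Context {R : realType} {d : nat}.
Local Notation Rd := (d.-tuple R).
Implicit Types (w x : Rd) (f g : Rd -> R[i]).

Definition character w x : R[i] := Complex (cos (tdot w x)) (sin (tdot w x)).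

Lemma characterDl w w' x :
  character (tadd w w') x = character w x * character w' x.
Proof.
by apply: complex_ext; rewrite ?crealM ?cimagM/= tdotDl ?cosD ?sinD; ring.
Qed.

Lemma characterDr w x y :
  character w (tadd x y) = character w x * character w y.
Proof.
by apply: complex_ext; rewrite ?crealM ?cimagM/= tdotDr ?cosD ?sinD; ring.
Qed.

Lemma cnorm_character w x : cnorm (character w x) = 1.
Proof. by rewrite cnormE/= cos2Dsin2 sqrtr1. Qed.

Lemma measurable_creal_character w :
  measurable_fun setT (fun x => creal (character w x)).
Proof.
apply: (measurableT_comp (f := @cos R)) (measurable_tdot w).
exact: continuous_measurable_fun (@continuous_cos R).
Qed.

Lemma measurable_cimag_character w :
  measurable_fun setT (fun x => cimag (character w x)).
Proof.
apply: (measurableT_comp (f := @sin R)) (measurable_tdot w).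
exact: continuous_measurable_fun (@continuous_sin R).
Qed.

Lemma character_Cintegrable (m : {finite_measure set Rd -> \bar R}) w :
  Cintegrable m (character w).
Proof.
apply: (bounded_Cintegrable _ (M := 1)) => [||x].
- exact: measurable_creal_character.
- exact: measurable_cimag_character.
- by rewrite cnorm_character.
Qed.

Inductive trigpoly : (Rd -> R[i]) -> Prop :=
| trigpoly_character w : trigpoly (character w)
| trigpolyD f g : trigpoly f -> trigpoly g -> trigpoly (fun x => f x + g x)
| trigpolyZ c f : trigpoly f -> trigpoly (fun x => c * f x).

Lemma trigpoly_ext f g : f =1 g -> trigpoly f -> trigpoly g.
Proof. by move=> /funext ->. Qed.

Lemma trigpolyM f g : trigpoly f -> trigpoly g -> trigpoly (fun x => f x * g x).
Proof.
move=> tf tg; elim: tf => {f} [w|f h _ tf _ th|c f _ tf].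
- elim: tg => {g} [v|g h _ tg _ th|c g _ tg].
  + apply: trigpoly_ext (trigpoly_character (tadd w v)) => x.
    by rewrite characterDl.
  + by apply: trigpoly_ext (trigpolyD tg th) => x; rewrite mulrDr.
  + by apply: trigpoly_ext (trigpolyZ c tg) => x; rewrite mulrCA.
- by apply: trigpoly_ext (trigpolyD tf th) => x; rewrite mulrDl.
- by apply: trigpoly_ext (trigpolyZ c tf) => x; rewrite mulrA.
Qed.

Lemma trigpoly_cst c : trigpoly (fun=> c).
Proof.
apply: trigpoly_ext (trigpolyZ c (trigpoly_character (cst_tuple 0))) => x.
rewrite /character (_ : tdot _ x = 0) ?cos0 ?sin0; first exact: mulr1.
by rewrite /tdot big1// => i _; rewrite tnth_mktuple mul0r.
Qed.

Lemma trigpolyX f k : trigpoly f -> trigpoly (fun x => f x ^+ k).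
Proof.
move=> tf; elim: k => [|k IH]; first exact: trigpoly_cst.
by apply: trigpoly_ext (trigpolyM tf IH) => x; rewrite exprS.
Qed.

Lemma trigpoly_prod (I : Type) (r : seq I) (F : I -> Rd -> R[i]) :
  (forall i, trigpoly (F i)) -> trigpoly (fun x => \prod_(i <- r) F i x).
Proof.
move=> tF; elim: r => [|i r IH].
  by apply: trigpoly_ext (trigpoly_cst 1) => x; rewrite big_nil.
by apply: trigpoly_ext (trigpolyM (tF i) IH) => x; rewrite big_cons.
Qed.

Lemma trigpoly_sin_coord (k c : R) (i : 'I_d) :
  trigpoly (fun x => (sin (k * tnth x i + c))%:C%C).
Proof.
pose axis (s : R) : Rd := [tuple (if j == i then s else 0) | j < d].
have tdot_axis s x : tdot (axis s) x = s * tnth x i.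
  rewrite /tdot (bigD1 i)//= tnth_mktuple eqxx big1 ?addr0// => j ji.
  by rewrite tnth_mktuple (negbTE ji) mul0r.
apply: trigpoly_ext (trigpolyD
  (trigpolyZ (Complex (sin c / 2) (- cos c / 2)) (trigpoly_character (axis k)))
  (trigpolyZ (Complex (sin c / 2) (cos c / 2))
    (trigpoly_character (axis (- k))))) => x.
apply: complex_ext; rewrite ?crealD ?cimagD ?crealM ?cimagM/= !tdot_axis.
  by rewrite !mulNr cosN !sinN sinD; field.
by rewrite !mulNr cosN !sinN; field.
Qed.

Lemma trigpoly_sine_step n (k c : R) (i : 'I_d) :
  trigpoly (fun x => (sine_step n (k * tnth x i + c))%:C%C).
Proof.
apply: trigpoly_ext (trigpolyX (2 ^ (8 ^ n - n)) (trigpolyD (trigpoly_cst 1)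
  (trigpolyZ (-1) (trigpolyX (8 ^ n) (trigpolyD (trigpoly_cst 2^-1)
  (trigpolyZ 2^-1 (trigpoly_sin_coord (k / 2 ^+ n) (c / 2 ^+ n) i))))))) => x.
rewrite /sine_step rmorphXn rmorphB rmorph1 rmorphXn rmorphM rmorphD rmorph1.
by rewrite fmorphV rmorph_nat mulN1r mulrDl mul1r mulrC mulrDl mulrAC.
Qed.

Lemma trigpoly_box_step a b n : trigpoly (fun x => (box_step a b n x)%:C%C).
Proof.
have tstep i : trigpoly (fun x => (sine_step n (tnth x i - tnth b i))%:C%C *
    (sine_step n (tnth a i - tnth x i))%:C%C).
  apply: trigpolyM.
    by apply: trigpoly_ext (trigpoly_sine_step n 1 (- tnth b i) i) => x;
      rewrite mul1r.
  by apply: trigpoly_ext (trigpoly_sine_step n (-1) (tnth a i) i) => x;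
    rewrite mulN1r addrC.
apply: trigpoly_ext (trigpoly_prod (index_enum 'I_d) tstep) => x.
by rewrite rmorph_prod; apply: eq_bigr => i _; rewrite rmorphM.
Qed.

Lemma trigpoly_Cintegrable (m : {finite_measure set Rd -> \bar R}) f :
  trigpoly f -> Cintegrable m f.
Proof.
elim=> {f} [w|f g _ fi _ gi|c f _ fi].
- exact: character_Cintegrable.
- exact: CintegrableD.
- exact: CintegrableZ.
Qed.

Lemma measurable_box_step a b n :
  measurable_fun setT (box_step a b n : Rd -> R).
Proof.
apply/measurable_EFinP.
exact: measurable_int (trigpoly_Cintegrable \d_a (trigpoly_box_step a b n)).1.
Qed.

End trigonometric_polynomials.

(** * Characteristic functions of finite measures *)

Section characteristic_functions.
Context {R : realType} {d : nat}.
Local Notation Rd := (d.-tuple R).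
Implicit Types (p q m : {finite_measure set Rd -> \bar R}) (w : Rd).

Definition fourier (m : {measure set Rd -> \bar R}) w : R[i] :=
  Cintegral m (character w).

Lemma Cintegral_trigpoly_fourier p q f : fourier p =1 fourier q ->
  trigpoly f -> Cintegral p f = Cintegral q f.
Proof.
move=> pq; elim=> {f} [w|f g tf fpq tg gpq|c f tf fpq].
- exact: pq.
- by rewrite !CintegralD ?fpq ?gpq//; exact: trigpoly_Cintegrable.
- by rewrite !CintegralZ ?fpq//; exact: trigpoly_Cintegrable.
Qed.

Lemma fourier_inj p q : fourier p =1 fourier q ->
  forall A, measurable A -> p A = q A.
Proof.
move=> pq; apply: (measure_unique _ _ measurable_boxes boxes_setI_closed
  boxes_cube bigcup_cube p q) => [_ [a [b ->]]|n]; last first.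
  by rewrite ltey_eq fin_num_measure//; exact: measurable_box.
have box_step_integral m :
    (fun n => \int[m]_x box_step a b n x) @ \oo --> fine (m (box a b)).
  rewrite (_ : fine _ = \int[m]_x \1_(box a b) x); last first.
    by rewrite /Rintegral integral_indic ?setIT//; exact: measurable_box.
  apply: (bounded_Rintegral_cvg (M := 1)) => [n|n x|x].
  - exact: measurable_box_step.
  - exact: norm_box_step_le1.
  - exact: box_step_cvg.
have box_fin m : m (box a b) \is a fin_num.
  by apply: fin_num_measure; exact: measurable_box.
rewrite -[LHS]fineK; last exact: box_fin.
rewrite -[RHS]fineK; last exact: box_fin.
congr EFin.
have pq_box_step : (fun n => \int[p]_x box_step a b n x) =
    (fun n => \int[q]_x box_step a b n x).
  apply/funext => n.
  have := Cintegral_trigpoly_fourier pq (trigpoly_box_step a b n).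
  by rewrite !Cintegral_real => -[].
apply: cvg_unique (box_step_integral p) _ => //.
by rewrite pq_box_step; exact: box_step_integral.
Qed.

Lemma fourier_cvg m (w_ : nat -> Rd) w :
  (forall i, (fun n => tnth (w_ n) i) @ \oo --> tnth w i) ->
  creal \o (fourier m \o w_) @ \oo --> creal (fourier m w) /\
  cimag \o (fourier m \o w_) @ \oo --> cimag (fourier m w).
Proof.
move=> ww; have tdot_cvg x : (fun n => tdot (w_ n) x) @ \oo --> tdot w x.
  apply: cvg_big => [|i _]; first exact: add_continuous.
  by apply: cvgM; [exact: ww|exact: cvg_cst].
split; apply: (bounded_Rintegral_cvg (M := 1)) => [n|n x|x].
- exact: measurable_creal_character.
- by rewrite (le_trans (norm_creal_le _))// cnorm_character.
- by apply: continuous_cvg; [exact: continuous_cos|exact: tdot_cvg].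
- exact: measurable_cimag_character.
- by rewrite (le_trans (norm_cimag_le _))// cnorm_character.
- by apply: continuous_cvg; [exact: continuous_sin|exact: tdot_cvg].
Qed.

Lemma fourier_ae_eq (leb : {measure set Rd -> \bar R}) p q :
  is_lebesgue leb -> {ae leb, forall w, fourier p w = fourier q w} ->
  fourier p =1 fourier q.
Proof.
move=> lebP pq w; have [w_ w_pq ww] := is_lebesgue_ae_dense lebP pq w.
have w_fourier : fourier p \o w_ = fourier q \o w_.
  by apply/funext => n; exact: w_pq.
have := fourier_cvg p ww; rewrite w_fourier => -[p_creal p_cimag].
have [q_creal q_cimag] := fourier_cvg q ww.
apply: complex_ext; first exact: cvg_unique p_creal q_creal.
exact: cvg_unique p_cimag q_cimag.
Qed.

End characteristic_functions.

(** * Convolution of finite measures *)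

Section product_integrals.
Context {d1 d2} {T1 : measurableType d1} {T2 : measurableType d2}.
Context {R : realType}.
Variables (m1 : {sigma_finite_measure set T1 -> \bar R}).
Variables (m2 : {sigma_finite_measure set T2 -> \bar R}).

Section real_valued.
Variables (a : T1 -> R) (b : T2 -> R).
Hypothesis inta : m1.-integrable setT (EFin \o a).
Hypothesis intb : m2.-integrable setT (EFin \o b).

Lemma integrable_prodM :
  (m1 \x m2)%E.-integrable setT (fun z => (a z.1 * b z.2)%:E).
Proof.
have /measurable_EFinP ma := measurable_int _ inta.
have /measurable_EFinP mb := measurable_int _ intb.
apply/integrable12ltyP => /=.
  apply/measurable_EFinP/measurable_funM; first exact: measurableT_comp ma _.
  exact: measurableT_comp mb _.
have [_ b_lty] := integrableP _ _ _ intb.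
under eq_integral => x _.
  under eq_integral do rewrite normrM EFinM.
  rewrite ge0_integralZl//; last exact/measurable_EFinP/measurableT_comp.
  over.
have /integrableP[_ a_lty] := inta.
rewrite ge0_integralZr//; last 2 first.
- exact/measurable_EFinP/measurableT_comp.
- exact: integral_ge0.
by rewrite lte_mul_pinfty ?integral_ge0// ge0_fin_numE ?integral_ge0.
Qed.

Lemma Rintegral_prodM : \int[(m1 \x m2)%E]_z (a z.1 * b z.2) =
  (\int[m1]_x a x) * (\int[m2]_x b x).
Proof.
apply: EFin_inj; rewrite EFin_Rintegral; last exact: integrable_prodM.
rewrite -integral12_prod_meas1; last exact: integrable_prodM.
rewrite /fubini_F/= EFinM (EFin_Rintegral inta) -integralZr//.
by apply: eq_integral => x _; rewrite EFin_Rintegral// -integralZl.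
Qed.

End real_valued.

Variables (f : T1 -> R[i]) (g : T2 -> R[i]).
Hypothesis intf : Cintegrable m1 f.
Hypothesis intg : Cintegrable m2 g.

Lemma Cintegrable_prodM : Cintegrable (m1 \x m2)%E (fun z => f z.1 * g z.2).
Proof.
have [[fr fi] [gr gi]] := (intf, intg); split.
- under [_ \o _]eq_fun do rewrite /= crealM EFinB.
  exact: integrableB (integrable_prodM fr gr) (integrable_prodM fi gi).
- under [_ \o _]eq_fun do rewrite /= cimagM EFinD.
  exact: integrableD (integrable_prodM fr gi) (integrable_prodM fi gr).
Qed.

Lemma Cintegral_prodM : Cintegral (m1 \x m2)%E (fun z => f z.1 * g z.2) =
  Cintegral m1 f * Cintegral m2 g.
Proof.
have [[fr fi] [gr gi]] := (intf, intg).
apply: complex_ext; rewrite ?crealM ?cimagM/= -!Rintegral_prodM//.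
- rewrite -(RintegralB _ (integrable_prodM fr gr) (integrable_prodM fi gi))//.
  by apply: eq_Rintegral => z _; rewrite crealM.
- rewrite -(RintegralD _ (integrable_prodM fr gi) (integrable_prodM fi gr))//.
  by apply: eq_Rintegral => z _; rewrite cimagM.
Qed.

End product_integrals.

Section measure_convolution.
Context {R : realType} {d : nat}.
Local Notation Rd := (d.-tuple R).
Variables p q : {finite_measure set Rd -> \bar R}.

Definition mconv : set Rd -> \bar R :=
  pushforward (p \x q)%E (fun z : Rd * Rd => tadd z.1 z.2).

(* Side condition of the measure structure of [pushforward] in the next three
   proofs, which close it by assumption. *)
Let mtadd : measurable_fun setT (fun z : Rd * Rd => tadd z.1 z.2).
Proof. exact: measurable_tadd. Qed.

Let mconv0 : mconv set0 = 0%E.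
Proof. exact: measure0. Qed.

Let mconv_ge0 A : (0 <= mconv A)%E.
Proof. exact: measure_ge0. Qed.

Let mconv_sigma_additive : semi_sigma_additive mconv.
Proof. exact: measure_semi_sigma_additive. Qed.

HB.instance Definition _ := isMeasure.Build _ _ _ mconv
  mconv0 mconv_ge0 mconv_sigma_additive.

Let mconv_fin : fin_num_fun mconv.
Proof.
move=> A mA; rewrite ge0_fin_numE//; apply: (@le_lt_trans _ _ (mconv setT)).
  by apply: le_measure; rewrite ?inE.
rewrite /mconv /pushforward (_ : _ @^-1` _ = setT `*` setT); last first.
  by apply/seteqP; split.
by rewrite product_measure1E// ltey_eq fin_numM ?fin_num_measure.
Qed.

HB.instance Definition _ := Measure_isFinite.Build _ Rd R mconv mconv_fin.

Lemma fourier_mconv w : fourier mconv w = fourier p w * fourier q w.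
Proof.
have intp := character_Cintegrable p w; have intq := character_Cintegrable q w.
have characterE : character w \o (fun z : Rd * Rd => tadd z.1 z.2) =
    fun z => character w z.1 * character w z.2.
  by apply/funext => z; exact: characterDr.
rewrite /fourier (Cintegral_image (m := (p \x q)%E) measurable_tadd)//.
- by rewrite characterE; exact: Cintegral_prodM.
- exact: measurable_creal_character.
- exact: measurable_cimag_character.
- by rewrite characterE; exact: Cintegrable_prodM.
Qed.

End measure_convolution.

(** * Densities *)

Section densities.
Context {R : realType} {d : nat}.
Local Notation Rd := (d.-tuple R).
Variable leb : {measure set Rd -> \bar R}.

Lemma eq_is_density (m m' : set Rd -> \bar R) (f : Rd -> R) :
  (forall A, measurable A -> m A = m' A) ->
  is_density leb m f -> is_density leb m' f.
Proof. by move=> mm' [mf f0 mfE]; split=> // A mA; rewrite -mm'// mfE. Qed.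

Lemma is_density_ae_unique (m : set Rd -> \bar R) (f g : Rd -> R) :
  (m setT < +oo)%E -> is_density leb m f -> is_density leb m g ->
  {ae leb, forall x, f x = g x}.
Proof.
move=> m_lty [mf f0 mfE] [mg g0 mgE].
have : ae_eq leb setT (EFin \o f) (EFin \o g).
  apply: integral_ae_eq => //.
  - apply/integrableP; split; first exact/measurable_EFinP.
    by under eq_integral do rewrite /= ger0_norm//; rewrite -mfE.
  - exact/measurable_EFinP.
  - by move=> A _ mA; rewrite -mfE// -mgE.
by apply: filterS => x /(_ I)[].
Qed.

Hypothesis lebP : is_lebesgue leb.
Local Open Scope ereal_scope.

Definition econv (m : {measure set Rd -> \bar R}) (f : Rd -> R) (y : Rd) :=
  \int[m]_x (f (tsub y x))%:E.

Section econv_density.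
Variables (nu : probability Rd R) (f : Rd -> R).
Hypothesis nuf : is_density leb nu f.
Variable m : {finite_measure set Rd -> \bar R}.

Let mf : measurable_fun setT f. Proof. by case: nuf. Qed.
Let f0 x : (0 <= f x)%R. Proof. by case: nuf. Qed.

Lemma measurable_translated_density y :
  measurable_fun setT (fun x => (f (tsub y x))%:E).
Proof.
apply/measurable_EFinP/(measurableT_comp mf).
exact: (measurableT_comp measurable_tsub (pair1_measurable y)).
Qed.

Lemma econv_ge0 y : 0 <= econv m f y.
Proof. by apply: integral_ge0 => x _; rewrite lee_fin. Qed.

Lemma econv_fmadd (m' : {finite_measure set Rd -> \bar R}) y :
  econv (fmadd m m') f y = econv m f y + econv m' f y.
Proof.
apply: ge0_integral_measure_add => // [x _|]; first by rewrite lee_fin.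
exact: measurable_translated_density.
Qed.

Let measurable_kernel :
  measurable_fun setT (fun z : Rd * Rd => (f (tsub z.2 z.1))%:E).
Proof.
apply/measurable_EFinP/(measurableT_comp mf).
exact: (measurableT_comp measurable_tsub
  (measurable_fun_pair measurable_snd measurable_fst)).
Qed.

Lemma measurable_econv : measurable_fun setT (econv m f).
Proof.
apply: (@measurable_fun_fubini_tonelli_G _ _ _ _ _ m
   (fun z : Rd * Rd => (f (tsub z.2 z.1))%:E)) => //.
by move=> z; rewrite lee_fin.
Qed.

Let leb_sigma_finite := isSigmaFinite.Build _ _ _ _
  (is_lebesgue_sigma_finite lebP).
Let leb_sfinite := isSFinite.Build _ _ _ _
  (sfinite_measure_sigma_finite (is_lebesgue_sigma_finite lebP)).
Let sigma_finite_leb := HB.pack_for {sigma_finite_measure set Rd -> \bar R}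
  (Measure.sort leb) leb_sfinite leb_sigma_finite.

Let integral_density_translate (A : set Rd) x : measurable A ->
  \int[leb]_y ((\1_A y)%:E * (f (tsub y x))%:E) = nu [set v | A (tadd v x)].
Proof.
move=> mA.
have mtadd : measurable_fun setT ((@tadd R d)^~ x).
  exact: (measurableT_comp measurable_tadd (pair2_measurable x)).
pose g v := (\1_A (tadd v x))%:E * (f v)%:E.
have mg : measurable_fun setT g.
  apply: emeasurable_funM; apply/measurable_EFinP => //.
  by apply: measurableT_comp mtadd; exact: measurable_indic.
have g0 v : 0 <= g v by rewrite mule_ge0// lee_fin.
transitivity (\int[leb]_y g (tsub y x)).
  by apply: eq_integral => y _; rewrite /g tsubK.
rewrite (ge0_integral_translation lebP)//.
have mAx : measurable [set v | A (tadd v x)].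
  by rewrite -[X in measurable X]setTI; apply: mtadd.
case: nuf => _ _ ->//; rewrite [RHS]integral_mkcond.
apply: eq_integral => v _; rewrite patchE /g indicE.
have -> : (tadd v x \in A) = (v \in [set v | A (tadd v x)]).
  by apply/idP/idP; rewrite !inE.
by case: ifPn => _; rewrite ?mul1e ?mul0e.
Qed.

Lemma integral_econv (A : set Rd) : measurable A ->
  \int[leb]_(y in A) econv m f y = mconv m nu A.
Proof.
move=> mA.
pose h (z : Rd * Rd) := (\1_A z.2)%:E * (f (tsub z.2 z.1))%:E.
have mh : measurable_fun setT h.
  apply: emeasurable_funM => //; apply/measurable_EFinP.
  by apply: measurableT_comp => //; exact: measurable_indic.
have h0 z : 0 <= h z by rewrite mule_ge0// lee_fin.
rewrite integral_mkcond.
transitivity (\int[sigma_finite_leb]_y \int[m]_x h (x, y)).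
  apply: eq_integral => y _; rewrite patchE /h/= indicE.
  case: ifPn => yA /=.
    by under eq_integral do rewrite mul1e.
  by under eq_integral do rewrite mul0e; rewrite integral0.
rewrite -(fubini_tonelli h)//.
rewrite /mconv /product_measure1; apply: eq_integral => x _ /=.
rewrite [LHS]integral_density_translate//; congr (nu _).
by apply/seteqP; split=> v; rewrite /xsection/= inE/= taddC.
Qed.

Lemma econv_fin_num : {ae leb, forall y, econv m f y \is a fin_num}.
Proof.
have econv_integrable : leb.-integrable setT (econv m f).
  apply/integrableP; split; first exact: measurable_econv.
  under eq_integral do rewrite gee0_abs ?econv_ge0//.
  by rewrite integral_econv//; exact: finite_measure_lty.
by apply: filterS (integrable_ae measurableT econv_integrable) => y /(_ I).
Qed.

Lemma econv_is_density :
  is_density leb (mconv m nu) (fun y => fine (econv m f y)).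
Proof.
have mfine : measurable_fun setT (fun y => fine (econv m f y)).
  by apply: measurableT_comp => //; exact: measurable_econv.
split=> [//|y|A mA]; first by rewrite fine_ge0// econv_ge0.
rewrite -integral_econv//; apply: ae_eq_integral => //.
- exact: measurable_funTS measurable_econv.
- exact/measurable_funTS/measurable_EFinP.
- by apply: filterS econv_fin_num => y yfin _; rewrite fineK.
Qed.

End econv_density.

Section deconvolution.
Variables (nu : probability Rd R) (f : Rd -> R).
Hypothesis nuf : is_density leb nu f.
Hypothesis nu0 : {ae leb, forall w, fourier nu w != 0%R}.

Lemma econv_inj (p q : {finite_measure set Rd -> \bar R}) :
  {ae leb, forall y, econv p f y = econv q f y} ->
  forall A, measurable A -> p A = q A.
Proof.
move=> pq; apply: fourier_inj; apply: (fourier_ae_eq lebP).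
have mconv_pq A : measurable A -> mconv p nu A = mconv q nu A.
  move=> mA; rewrite -!(integral_econv nuf)//; apply: ae_eq_integral => //.
  - exact: measurable_funTS (measurable_econv nuf p).
  - exact: measurable_funTS (measurable_econv nuf q).
  - by apply: filterS pq.
apply: filterS nu0 => w nu_w0; apply: (mulIf nu_w0).
by rewrite -!fourier_mconv; exact: eq_measure_Cintegral.
Qed.

End deconvolution.
End densities.

(** * Functions vanishing at infinity and complex measures *)

Section C0_functions.
Context {R : realType} {d : nat}.
Local Notation Rd := (d.-tuple R).
Variable h : Rd -> R[i].
Hypothesis hC0 : C0fun h.

Lemma C0fun_creal : tcontinuous (fun x => creal (h x)).
Proof.
move=> x e e0; have [delta delta0 xh] := hC0.1 x e e0.
by exists delta => // y /xh; apply: le_lt_trans; rewrite -crealB norm_creal_le.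
Qed.

Lemma C0fun_cimag : tcontinuous (fun x => cimag (h x)).
Proof.
move=> x e e0; have [delta delta0 xh] := hC0.1 x e e0.
by exists delta => // y /xh; apply: le_lt_trans; rewrite -cimagB norm_cimag_le.
Qed.

Lemma C0fun_bounded : exists2 M : R, 0 < M & forall x, cnorm (h x) <= M.
Proof.
have [L hL] := hC0.2 1 ltr01.
have [A hA] := tcontinuous_bounded L C0fun_creal.
have [B hB] := tcontinuous_bounded L C0fun_cimag.
exists (`|A| + `|B| + 1) => [|x]; first by rewrite ltr_wpDl// addr_ge0.
have [xL|Lx] := leP (tnorm x) L.
  rewrite (le_trans (cnorm_le_sum _))//.
  have := ler_norm A; have := ler_norm B.
  by have := hA x xL; have := hB x xL; lra.
by rewrite ltW// (lt_le_trans (hL x Lx))// lerDr addr_ge0.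
Qed.

Lemma C0fun_Cintegrable (m : {finite_measure set Rd -> \bar R}) :
  Cintegrable m h.
Proof.
have [M _ hM] := C0fun_bounded; apply: bounded_Cintegrable hM.
- exact: tcontinuous_measurable C0fun_creal.
- exact: tcontinuous_measurable C0fun_cimag.
Qed.

Lemma C0funZ (a : R[i]) : C0fun (fun x => a * h x).
Proof.
have a0 : 0 < cnorm a + 1 by rewrite ltr_wpDl// cnorm_ge0.
have scale_lt (e : R) z : cnorm z < e / (cnorm a + 1) -> cnorm (a * z) < e.
  rewrite ltr_pdivlMr// cnormM; apply: le_lt_trans.
  by rewrite mulrC ler_wpM2l ?lerDl// cnorm_ge0.
split=> [x e e0|e e0].
  have [|delta delta0 xh] := hC0.1 x (e / (cnorm a + 1)).
    by rewrite divr_gt0.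
  by exists delta => // y /xh/scale_lt; rewrite mulrBr.
have [|M Mh] := hC0.2 (e / (cnorm a + 1)); first by rewrite divr_gt0.
by exists M => x /Mh/scale_lt.
Qed.

End C0_functions.

Section complex_measures.
Context {R : realType} {d : nat}.
Local Notation Rd := (d.-tuple R).
Local Notation cmeasure := (@cmeasure R d).
Implicit Types (mu nu : cmeasure) (h : Rd -> R[i]).

Definition cmadd mu nu := CMeasure
  (fmadd (cm_rpos mu) (cm_rpos nu)) (fmadd (cm_rneg mu) (cm_rneg nu))
  (fmadd (cm_ipos mu) (cm_ipos nu)) (fmadd (cm_ineg mu) (cm_ineg nu)).
Definition cmscale (k : {nonneg R}) mu := CMeasure
  (mscale k (cm_rpos mu)) (mscale k (cm_rneg mu))
  (mscale k (cm_ipos mu)) (mscale k (cm_ineg mu)).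
Definition cmopp mu :=
  CMeasure (cm_rneg mu) (cm_rpos mu) (cm_ineg mu) (cm_ipos mu).
Definition cmrot mu :=
  CMeasure (cm_ineg mu) (cm_ipos mu) (cm_rpos mu) (cm_rneg mu).

Definition cm_integrable mu h :=
  [/\ Cintegrable (cm_rpos mu) h, Cintegrable (cm_rneg mu) h,
      Cintegrable (cm_ipos mu) h & Cintegrable (cm_ineg mu) h].

Lemma cintE mu h : cint mu h =
  (Cintegral (cm_rpos mu) h - Cintegral (cm_rneg mu) h) +
  'i%C * (Cintegral (cm_ipos mu) h - Cintegral (cm_ineg mu) h).
Proof. by apply: complex_ext => /=; ring. Qed.

Lemma cint_cmadd mu nu h : cm_integrable mu h -> cm_integrable nu h ->
  cint (cmadd mu nu) h = cint mu h + cint nu h.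
Proof.
move=> [? ? ? ?] [? ? ? ?].
by rewrite !cintE/= !Cintegral_fmadd//; ring.
Qed.

Lemma cint_cmscale k mu h : cm_integrable mu h ->
  cint (cmscale k mu) h = k%:num%:C%C * cint mu h.
Proof. by move=> [? ? ? ?]; rewrite !cintE/= !Cintegral_mscale//; ring. Qed.

Lemma cint_cmopp mu h : cint (cmopp mu) h = - cint mu h.
Proof. by rewrite !cintE/=; ring. Qed.

Lemma cint_cmrot mu h : cint (cmrot mu) h = 'i%C * cint mu h.
Proof. by apply: complex_ext => /=; ring. Qed.

Lemma cintZ (a : R[i]) mu h : cm_integrable mu h ->
  cint mu (fun x => a * h x) = a * cint mu h.
Proof. by move=> [? ? ? ?]; rewrite !cintE !CintegralZ//; ring. Qed.

Lemma C0fun_cm_integrable mu h : C0fun h -> cm_integrable mu h.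
Proof. by move=> hC0; split; exact: C0fun_Cintegrable. Qed.

Lemma cnorm_cint_bounded mu : exists B, forall h, C0fun h ->
  (forall x, cnorm (h x) <= 1) -> cnorm (cint mu h) <= B.
Proof.
pose mass (m : {finite_measure set Rd -> \bar R}) := (1 * fine (m setT)) *+ 2.
exists (mass (cm_rpos mu) + mass (cm_rneg mu) +
        (mass (cm_ipos mu) + mass (cm_ineg mu))) => h hC0 h1.
have cnorm_mass (m : {finite_measure set Rd -> \bar R}) :
    cnorm (Cintegral m h) <= mass m.
  by apply: cnorm_Cintegral_le => //; exact: C0fun_Cintegrable.
rewrite cintE (le_trans (cnormD _ _))// cnormM cnorm_i mul1r.
by apply: lerD; rewrite (le_trans (cnormD _ _))// cnormN lerD.
Qed.

Lemma cnorm_cint_le_tvnorm mu h (M : R) : C0fun h -> 0 < M ->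
  (forall x, cnorm (h x) <= M) -> cnorm (cint mu h) <= M * tvnorm mu.
Proof.
move=> hC0 M0 hM; rewrite -ler_pdivrMl//.
have Mscaled z : cnorm ((M^-1)%:C%C * z) = M^-1 * cnorm z.
  by rewrite cnormM cnorm_real gtr0_norm ?invr_gt0.
have [B cintB] := cnorm_cint_bounded mu.
pose unit_h x := (M^-1)%:C%C * h x.
have unit_hP : C0fun unit_h /\ forall x, cnorm (unit_h x) <= 1.
  by split=> [|x]; [exact: C0funZ|rewrite Mscaled ler_pdivrMl// mulr1].
have unit_h_cint : M^-1 * cnorm (cint mu h) = cnorm (cint mu unit_h).
  by rewrite cintZ ?Mscaled//; exact: C0fun_cm_integrable.
apply: sup_upper_bound.
  split; last by exists B => _ [g [gC0 g1 ->]]; exact: cintB.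
  by exists (cnorm (cint mu unit_h)), unit_h; have [] := unit_hP.
by exists unit_h; have [] := unit_hP.
Qed.

End complex_measures.

(** * Admissible mixtures *)

Section admissible_mixtures.
Context {R : realType} {d : nat}.
Local Notation Rd := (d.-tuple R).
Local Notation cmeasure := (@cmeasure R d).
Variable leb : {measure set Rd -> \bar R}.
Hypothesis lebP : is_lebesgue leb.
Variables (nu : probability Rd R) (f : Rd -> R).
Hypothesis nuf : is_density leb nu f.
Implicit Types (mu : cmeasure) (g : Rd -> R[i]).

Lemma creal_Kconv mu y : creal (Kconv f mu y) =
  fine (econv (cm_rpos mu) f y) - fine (econv (cm_rneg mu) f y).
Proof. by rewrite /Kconv /cint/= !Rintegral_cst// !mul0r !subr0. Qed.

Lemma cimag_Kconv mu y : cimag (Kconv f mu y) =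
  fine (econv (cm_ipos mu) f y) - fine (econv (cm_ineg mu) f y).
Proof. by rewrite /Kconv /cint/= !Rintegral_cst// !mul0r !subr0 add0r. Qed.

Lemma Kconv_cm_of (m : {finite_measure set Rd -> \bar R}) y :
  Kconv f (cm_of m) y = (fine (econv m f y))%:C%C.
Proof.
apply: complex_ext; rewrite ?creal_Kconv ?cimag_Kconv/=.
  by rewrite /econv integral_measure_zero subr0.
by rewrite /econv integral_measure_zero subr0.
Qed.

Lemma ae_Cintegrable_kernel (m : {finite_measure set Rd -> \bar R}) :
  {ae leb, forall y, Cintegrable m (fun x => (f (tsub y x))%:C%C)}.
Proof.
apply: filterS (econv_fin_num lebP nuf m) => y yfin.
have f0 x : 0 <= f x by case: nuf.
split; last exact: integrable0.
apply/integrableP; split; first exact: measurable_translated_density nuf y.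
under eq_integral do rewrite /= ger0_norm//.
by rewrite -[X in (X < _)%E]/(econv m f y) ltey_eq yfin.
Qed.

Lemma ae_cm_integrable_kernel mu :
  {ae leb, forall y, cm_integrable mu (fun x => (f (tsub y x))%:C%C)}.
Proof.
apply: filterS3 (ae_Cintegrable_kernel (cm_rpos mu))
  (ae_Cintegrable_kernel (cm_rneg mu)) (filterI
  (ae_Cintegrable_kernel (cm_ipos mu)) (ae_Cintegrable_kernel (cm_ineg mu))).
by move=> y ? ? [].
Qed.

Section injectivity.
Hypothesis nu0 : {ae leb, forall w, fourier nu w != 0}.

(* Moving the negative parts across the equality reduces the injectivity of
   convolution on signed measures to positive ones. *)
Lemma signed_econv_inj (p p' q q' : {finite_measure set Rd -> \bar R}) :
  {ae leb, forall y, fine (econv p f y) - fine (econv p' f y) =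
                     fine (econv q f y) - fine (econv q' f y)} ->
  forall A, measurable A -> fmadd p q' A = fmadd q p' A.
Proof.
move=> pq; apply: (econv_inj lebP nuf nu0).
have fin m := econv_fin_num lebP nuf m.
apply: filterS3 pq (filterI (fin p) (fin p')) (filterI (fin q) (fin q')) =>
  y pqy [p1 p2] [q1 q2].
rewrite !(econv_fmadd nuf) -(fineK p1) -(fineK p2) -(fineK q1) -(fineK q2).
by rewrite -!EFinD; congr EFin; lra.
Qed.

Lemma signed_Cintegral_inj (p p' q q' : {finite_measure set Rd -> \bar R})
    (h : Rd -> R[i]) :
  {ae leb, forall y, fine (econv p f y) - fine (econv p' f y) =
                     fine (econv q f y) - fine (econv q' f y)} ->
  Cintegrable p h -> Cintegrable p' h -> Cintegrable q h -> Cintegrable q' h ->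
  Cintegral p h - Cintegral p' h = Cintegral q h - Cintegral q' h.
Proof.
move=> /signed_econv_inj pq ph p'h qh q'h; apply/eqP.
by rewrite subr_eq addrAC eq_sym subr_eq -!Cintegral_fmadd// eq_sym;
  apply/eqP/eq_measure_Cintegral.
Qed.

Lemma Kconv_inj mu mu' h : cm_integrable mu h -> cm_integrable mu' h ->
  {ae leb, forall y, Kconv f mu y = Kconv f mu' y} -> cint mu h = cint mu' h.
Proof.
move=> [? ? ? ?] [? ? ? ?] mumu'; rewrite !cintE; congr (_ + _ * _).
- apply: signed_Cintegral_inj => //.
  by apply: filterS mumu' => y; rewrite -!creal_Kconv => ->.
- apply: signed_Cintegral_inj => //.
  by apply: filterS mumu' => y; rewrite -!cimag_Kconv => ->.
Qed.

End injectivity.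

Section mixture_integrals.
Variable lam : Rd -> R[i].
Hypothesis lam_integrable : forall mu, cm_integrable mu lam.

Definition mixture_integral g (z : R[i]) :=
  exists2 mu, {ae leb, forall y, g y = Kconv f mu y} & cint mu lam = z.

Lemma mixture_integralD g g' z z' :
  mixture_integral g z -> mixture_integral g' z' ->
  mixture_integral (fun y => g y + g' y) (z + z').
Proof.
move=> [mu gmu <-] [mu' gmu' <-]; exists (cmadd mu mu'); last exact: cint_cmadd.
apply: filterS3 gmu gmu' (filterI (ae_cm_integrable_kernel mu)
  (ae_cm_integrable_kernel mu')) => y -> -> [? ?].
by rewrite /Kconv cint_cmadd.
Qed.

Lemma mixture_integralN g z :
  mixture_integral g z -> mixture_integral (fun y => - g y) (- z).
Proof.
move=> [mu gmu <-]; exists (cmopp mu); last exact: cint_cmopp.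
by apply: filterS gmu => y ->; rewrite /Kconv cint_cmopp.
Qed.

Lemma mixture_integral_rot g z :
  mixture_integral g z -> mixture_integral (fun y => 'i%C * g y) ('i%C * z).
Proof.
move=> [mu gmu <-]; exists (cmrot mu); last exact: cint_cmrot.
by apply: filterS gmu => y ->; rewrite /Kconv cint_cmrot.
Qed.

Lemma mixture_integral_nonneg (k : {nonneg R}) g z : mixture_integral g z ->
  mixture_integral (fun y => k%:num%:C%C * g y) (k%:num%:C%C * z).
Proof.
move=> [mu gmu <-]; exists (cmscale k mu); last exact: cint_cmscale.
apply: filterS2 gmu (ae_cm_integrable_kernel mu) => y -> ?.
by rewrite /Kconv cint_cmscale.
Qed.

Lemma mixture_integral_real (k : R) g z : mixture_integral g z ->
  mixture_integral (fun y => k%:C%C * g y) (k%:C%C * z).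
Proof.
move=> gz; have [k0|k0] := leP 0 k.
  exact: (mixture_integral_nonneg (NngNum k0) gz).
have k0' : 0 <= - k by rewrite oppr_ge0 ltW.
have := mixture_integralN (mixture_integral_nonneg (NngNum k0') gz).
rewrite /= rmorphN mulNr opprK.
by under [X in mixture_integral X]eq_fun do rewrite mulNr opprK.
Qed.

Lemma mixture_integralZ (a : R[i]) g z :
  mixture_integral g z -> mixture_integral (fun y => a * g y) (a * z).
Proof.
move=> gz; have aE w : a * w = (creal a)%:C%C * w + 'i%C * ((cimag a)%:C%C * w).
  by apply: complex_ext; rewrite ?(crealD, cimagD, crealM, cimagM)/=; ring.
rewrite aE; under [X in mixture_integral X]eq_fun do rewrite aE.
apply: mixture_integralD; first exact: mixture_integral_real.
exact/mixture_integral_rot/mixture_integral_real.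
Qed.

Definition mixture_functional g : R[i] := xget 0 (mixture_integral g).

Lemma inAV_mixture_integral g :
  inAV leb f g -> mixture_integral g (mixture_functional g).
Proof. by move=> [mu gmu]; apply: (xgetI 0 (x := cint mu lam)); exists mu. Qed.

Hypothesis nu0 : {ae leb, forall w, fourier nu w != 0}.

Lemma mixture_functionalE g z :
  mixture_integral g z -> mixture_functional g = z.
Proof.
move=> gz; apply: xget_unique => // z'; move: gz => [mu gmu <-] [mu' gmu' <-].
apply: (Kconv_inj nu0) => //.
by apply: filterS2 gmu gmu' => y <- <-.
Qed.

Lemma mixture_functional_cint mu g : {ae leb, forall y, g y = Kconv f mu y} ->
  mixture_functional g = cint mu lam.
Proof. by move=> gmu; apply: mixture_functionalE; exists mu. Qed.

Lemma mixture_functional_Kconv mu :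
  mixture_functional (Kconv f mu) = cint mu lam.
Proof. by apply: mixture_functional_cint; exact: aeW. Qed.

Lemma mixture_functional_AVdual : C0fun lam -> AVdual leb f mixture_functional.
Proof.
move=> lamC0; split=> [g g' [mu gmu] gg'|g g' a b gAV g'AV|].
- rewrite (mixture_functional_cint gmu); apply/esym/mixture_functional_cint.
  by apply: filterS2 gmu gg' => y -> ->.
- by apply: mixture_functionalE; apply: mixture_integralD;
    apply: mixture_integralZ; exact: inAV_mixture_integral.
- have [M M0 lamM] := C0fun_bounded lamC0.
  exists M => g [mu0 gmu0]; rewrite -ler_pdivrMl//.
  apply: lb_le_inf; first by exists (tvnorm mu0), mu0.
  move=> _ [mu gmu <-]; rewrite ler_pdivrMl// (mixture_functional_cint gmu).
  exact: cnorm_cint_le_tvnorm.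
Qed.

End mixture_integrals.

Lemma AVdual_Kconv_unique (T T' : (Rd -> R[i]) -> R[i]) :
  AVdual leb f T -> AVdual leb f T' ->
  (forall mu, T (Kconv f mu) = T' (Kconv f mu)) ->
  forall g, inAV leb f g -> T g = T' g.
Proof.
move=> [T_ae _ _] [T'_ae _ _] TT' g gAV; have [mu gmu] := gAV.
by rewrite (T_ae _ _ gAV gmu) (T'_ae _ _ gAV gmu).
Qed.

End admissible_mixtures.

(** * Sums of independent random vectors *)

Section random_vectors.
Context {R : realType} {d : nat} {dO : measure_display}.
Context {Omega : measurableType dO} {P : probability Omega R}.
Local Notation Rd := (d.-tuple R).
Implicit Types X V : {RV P >-> Rd}.

Lemma charfun_fourier V w : charfun P V w = fourier (distribution P V) w.
Proof.
rewrite /fourier (Cintegral_image (measurable_funPT V) (m := P))//.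
- exact: measurable_creal_character.
- exact: measurable_cimag_character.
apply: (bounded_Cintegrable _ (M := 1)) => [||o].
- exact: measurableT_comp (measurable_creal_character w) _.
- exact: measurableT_comp (measurable_cimag_character w) _.
- by rewrite (cnorm_character w (V o)).
Qed.

Lemma law_tadd X V (A : set Rd) : independent P X V -> measurable A ->
  law P (fun o => tadd (X o) (V o)) A =
  mconv (distribution P X) (distribution P V) A.
Proof.
move=> XV mA.
have mXV : measurable_fun setT (fun o => (X o, V o)).
  exact: measurable_fun_pair.
pose joint : {measure set (Rd * Rd) -> \bar R} :=
  pushforward P (fun o => (X o, V o)).
have mtaddA : measurable [set z : Rd * Rd | A (tadd z.1 z.2)].
  by rewrite -[X in measurable X]setTI; exact: measurable_tadd.
by apply/esym; exact: (product_measure_unique (m' := joint mXV)).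
Qed.

End random_vectors.

Theorem theorem1 (R : realType) (d : nat) (dO : measure_display)
  (Omega : measurableType dO) (P : probability Omega R)
  (leb : {measure set (d.-tuple R) -> \bar R})
  (V : {RV P >-> d.-tuple R}) (fV : d.-tuple R -> R) :
  is_lebesgue leb ->
  is_density leb (law P V) fV ->
  {ae leb, forall w, charfun P V w != 0} ->
  forall lam : d.-tuple R -> R[i], C0fun lam ->
  exists T : (d.-tuple R -> R[i]) -> R[i],
    [/\ AVdual leb fV T,
        (forall mu : cmeasure, T (Kconv fV mu) = cint mu lam),
        (forall T' : (d.-tuple R -> R[i]) -> R[i], AVdual leb fV T' ->
           (forall mu : cmeasure, T' (Kconv fV mu) = cint mu lam) ->
           forall f, inAV leb fV f -> T' f = T f) &
        (forall X : {RV P >-> d.-tuple R}, independent P X V ->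
           let Y := fun o => tadd (X o) (V o) in
           let PX := cm_of (distribution P X) in
           [/\ is_density leb (law P Y) (fun y => creal (Kconv fV PX y)),
               (forall y, cimag (Kconv fV PX y) = 0) &
               forall fY, is_density leb (law P Y) fY ->
                 T (fun y => (fY y)%:C%C) = cint PX lam])].
Proof.
move=> lebP Vf charfun0 lam lamC0.
have nuf : is_density leb (distribution P V : probability _ _) fV by exact: Vf.
have nu0 : {ae leb, forall w, fourier (distribution P V) w != 0}.
  by apply: filterS charfun0 => w; rewrite charfun_fourier.
have lam_integrable mu : cm_integrable mu lam by exact: C0fun_cm_integrable.
have T_AVdual := mixture_functional_AVdual lebP nuf lam_integrable nu0 lamC0.
have T_Kconv mu := mixture_functional_Kconv lebP nuf lam_integrable nu0 mu.
exists (mixture_functional leb fV lam); split => //.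
  move=> T' T'_AVdual T'_Kconv; apply: AVdual_Kconv_unique T'_AVdual T_AVdual _.
  by move=> mu; rewrite T'_Kconv T_Kconv.
move=> X XV Y PX.
have KconvE := Kconv_cm_of fV (distribution P X).
have Y_density : is_density leb (law P Y) (fun y => creal (Kconv fV PX y)).
  under eq_fun do rewrite KconvE.
  apply: eq_is_density (econv_is_density lebP nuf (distribution P X)) => A mA.
  by rewrite -law_tadd.
split=> // [y|fY fY_density]; first by rewrite KconvE.
apply: (mixture_functional_cint lebP nuf lam_integrable nu0).
have Y_lty : (law P Y setT < +oo)%E.
  by rewrite /law preimage_setT probability_setT ltry.
apply: filterS (is_density_ae_unique Y_lty fY_density Y_density) => y ->.
by rewrite KconvE.
Qed.
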